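(* Let $p$ be a prime, $n\ge 2$, and let $L:\mathbb{F}_p^n\rightarrow\mathbb{F}_p^{n-1}$ be the linear map $L(x_1,\ldots,x_n)=(x_1+x_n,x_2+x_n,\ldots,x_{n-1}+x_n)$. Let $S_1,\ldots,S_n\subseteq\mathbb{F}_p$ with $|S_i|=k$ for all $i\in[n]$, where $k>\frac{(n-1)p}{n}$. Then $|L(S_1,\ldots,S_n)|=p^{n-1}$, i.e., $L(S_1,\ldots,S_n)=\mathbb{F}_p^{n-1}$.
   Context: $L(S_1,\ldots,S_n)$ denotes the image of $S_1\times\cdots\times S_n$ under $L$. *)

(* Defs.v *)
From HB Require Import structures.
From mathcomp Require Import all_boot all_order all_algebra.

Set Implicit Arguments.
Unset Strict Implicit.
Unset Printing Implicit Defensive.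

Import Order.TTheory GRing.Theory Num.Theory.
Local Open Scope ring_scope.

Definition last_ord (n : nat) (hn : (1 < n)%N) : 'I_n :=
  Ordinal (etrans (ltn_predL n) (ltnW hn)).

(* Coordinates are numbered from 0: x_1, ..., x_n are x 0 0, ..., x 0 (n-1),
   and the i-th coordinate of the image is x_i + x_n, for i < n-1. *)
Definition Lmap (F : fieldType) (n : nat) (hn : (1 < n)%N) (x : 'rV[F]_n) :
    'rV[F]_n.-1 :=
  \row_(i < n.-1) (x 0 (widen_ord (leq_pred n) i) + x 0 (last_ord hn)).

Fact Lmap_is_linear (F : fieldType) (n : nat) (hn : (1 < n)%N) :
  linear (@Lmap F n hn).
Proof. by move=> a x y; apply/rowP => i; rewrite !mxE mulrDr addrACA. Qed.

HB.instance Definition _ (F : fieldType) (n : nat) (hn : (1 < n)%N) :=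
  GRing.isLinear.Build F 'rV[F]_n 'rV[F]_n.-1 *:%R (@Lmap F n hn)
    (@Lmap_is_linear F n hn).

(* The product S_1 x ... x S_n, as a set of row vectors. *)
Definition box (F : finFieldType) (n : nat) (S : 'I_n -> {set F}) :
    {set 'rV[F]_n} :=
  [set x : 'rV[F]_n | [forall i, x 0 i \in S i]].

(* Main.v *)
Require Import Defs.
From HB Require Import structures.
From mathcomp Require Import all_boot all_order all_algebra.

Set Implicit Arguments.
Unset Strict Implicit.
Unset Printing Implicit Defensive.

Import Order.TTheory GRing.Theory Num.Theory.
Local Open Scope ring_scope.

(** The fibre of [L] over [y] is the line of points [(y_1 - t, ..., y_{n-1} - t, t)].
    Each coordinate is an injective function of [t], hence leaves [S_i] for
    at most [p - k] values of [t]; as [n (p - k) < p], some [t] keeps all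
    coordinates in their sets. *)

(** Union bound: if no point were common to all [A i], their complements would cover [T], so their
    sizes would add up to at least [#|T|]. *)
Lemma common_point (I T : finType) (A : I -> {set T}) :
  (\sum_i #|~: A i| < #|T|)%N -> exists t, forall i, t \in A i.
Proof.
move=> ltT; suff /set0Pn[t tA] : \bigcap_i A i != set0.
  by exists t => i; move/bigcapP: tA; apply.
apply: contraTneq ltT => A0; rewrite -leqNgt -cardsT -setC0 -A0 setC_bigcap.
elim/big_rec2: _ => [|i m B _ leB]; first by rewrite cards0.
by rewrite (leq_trans (leq_card_setU _ _)) ?leq_add2l.
Qed.

Lemma card_preimsetC_inj (T : finType) (f : T -> T) (A : {set T}) :
  injective f -> #|~: (f @^-1: A)| = (#|T| - #|A|)%N.
Proof.
move=> f_inj; have := card_preimset (~: A) f_inj; rewrite preimsetC => ->.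
by rewrite -(cardsC A) addKn.
Qed.

(** [insub] targets ['I_n.-1], so it fails exactly at the last index, which is where the parameter
    [t] itself sits. *)
Definition Lmap_fiber (F : fieldType) (n : nat) (y : 'rV[F]_n.-1) (t : F) :
    'rV[F]_n :=
  \row_i (if insub (i : nat) is Some j then y 0 j - t else t).

Lemma Lmap_fiberK (F : fieldType) (n : nat) (hn : (1 < n)%N)
    (y : 'rV[F]_n.-1) (t : F) :
  Lmap hn (Lmap_fiber y t) = y.
Proof.
by apply/rowP => i; rewrite !mxE /= valK insubF ?ltnn // subrK.
Qed.

Lemma Lmap_fiber_inj (F : fieldType) (n : nat) (y : 'rV[F]_n.-1) (i : 'I_n) :
  injective (fun t => Lmap_fiber y t 0 i).
Proof.
move=> t u; rewrite !mxE; case: insub => // j.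
by move/addrI/oppr_inj.
Qed.

Lemma Lmap_box_full (F : finFieldType) (n : nat) (hn : (1 < n)%N)
    (S : 'I_n -> {set F}) :
  (\sum_i (#|F| - #|S i|) < #|F|)%N -> Lmap hn @: box S = [set: 'rV[F]_n.-1].
Proof.
move=> ltF; apply/setP => y; rewrite inE.
(* [A i] holds the parameters whose fibre point meets the constraint on coordinate [i]. *)
pose A i := (fun t => Lmap_fiber y t 0 i) @^-1: S i.
have [|t tA] := @common_point _ _ A.
  rewrite (eq_bigr (fun i => #|F| - #|S i|)%N) // => i _.
  exact/card_preimsetC_inj/Lmap_fiber_inj.
apply/imsetP; exists (Lmap_fiber y t); last by rewrite Lmap_fiberK.
by rewrite inE; apply/forallP => i; have := tA i; rewrite inE.
Qed.

Theorem theorem3 (p : nat) (hp : prime p) (n : nat) (hn : (1 < n)%N)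
    (k : nat) (S : 'I_n -> {set 'F_p})
    (hS : forall i : 'I_n, #|S i| = k)
    (hk : ((n.-1)%:R * p%:R) / n%:R < k%:R :> rat) :
  #|Lmap hn @: box S| = (p ^ n.-1)%N /\
  Lmap hn @: box S = [set: 'rV['F_p]_n.-1].
Proof.
have n_gt0 : (0 < n)%N := ltnW hn.
have ltnk : (n.-1 * p < k * n)%N.
  by move: hk; rewrite ltr_pdivrMr ?ltr0n // -!natrM ltr_nat.
have full : Lmap hn @: box S = [set: 'rV['F_p]_n.-1].
  apply: Lmap_box_full; under eq_bigr do rewrite hS card_Fp //.
  rewrite sum_nat_const card_ord card_Fp // mulnBr ltn_subLR; last first.
    (* Truncated subtraction calls for [k <= p]; any one of the sets, here the last, gives it as a
       subset of ['F_p]. *)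
    by rewrite leq_mul2l -(card_Fp hp) -(hS (last_ord hn)) max_card orbT.
  (* Splitting [n * p] as [p + n.-1 * p] and cancelling [p] leaves [ltnk]. *)
  by rewrite -{1}(prednK n_gt0) mulSn addnC ltn_add2r [(n * k)%N]mulnC.
by rewrite full cardsT card_mx card_Fp // mul1n.
Qed.
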